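(* Let $f:[0,1]\setminus\{c\}\to[0,1]$ be a non-flat $C^{1+}$ expanding Lorenz map and $c\in(0,1)$ its singularity. Suppose that $$\limsup_{n\to\infty}\frac{1}{n}\sum_{j=1}^{n}-\log|f^j(c_-)-c|<+\infty\quad\text{and}\quad\limsup_{n\to\infty}\frac{1}{n}\sum_{j=1}^{n}-\log|f^j(c_+)-c|<+\infty .$$ Then there is $\Upsilon>0$ such that $$\int_{[0,1]}|\log|x-c||\,d\mu(x)\le\Upsilon\quad\text{for every }\mu\in\mathcal{M}^1(f).$$ Moreover, every ergodic $\mu\in\mathcal{M}^1(f)$ satisfies the slow recurrence condition to the singularity $c$, and the Lyapunov exponents of the invariant measures are bounded above: there is $L<+\infty$ such that $\int\log f'\,d\mu\le L$ for every $\mu\in\mathcal{M}^1(f)$.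
   Context: $C^{1+}$ means $C^1$ with (locally) Hölder continuous derivative. The convention $-\log 0=+\infty$ is used. Expanding Lorenz map: for $0<c<1$, a $C^{1+}$ map $f:[0,1]\setminus\{c\}\to[0,1]$ such that $f(0)=0$, $f(1)=1$, there is a constant $\sigma>1$ with $f'(x)\ge\sigma$ for all $x\in[0,1]\setminus\{c\}$, and $f'(c_-)=f'(c_+)=+\infty$. The point $c$ is called the singularity. Here $f'(c_-)=\lim_{x\uparrow c}f'(x)$, $f'(c_+)=\lim_{x\downarrow c}f'(x)$, and for $n\ge1$, $f^n(c_-)=\lim_{x\uparrow c}f^n(x)$, $f^n(c_+)=\lim_{x\downarrow c}f^n(x)$. Non-flat: there exist constants $\alpha,\beta\in(0,1)$, $d_0,d_1\in[0,1]$ and $C^{1+}$ diffeomorphisms $\phi_0:[0,c]\to[0,d_0^{1/\alpha}]$ and $\phi_1:[c,1]\to[0,d_1^{1/\beta}]$ with $\phi_0(c)=\phi_1(c)=0$, $\phi_0(0)=d_0^{1/\alpha}$, $\phi_1(1)=d_1^{1/\beta}$, such that $f(x)=d_0-(\phi_0(x))^{\alpha}$ for $x<c$ and $f(x)=1-d_1+(\phi_1(x))^{\beta}$ for $x>c$. $\mathcal{M}^1(f)$ is the set of all $f$-invariant Borel probabilities $\mu$ on $[0,1]$, i.e. $\mu(f^{-1}(B))=\mu(B)$ for all Borel $B\subset[0,1]$, where $f^{-1}(B)\subset[0,1]\setminus\{c\}$ (so $\mu(\{c\})=0$). The Lyapunov exponent of $\mu$ is $\int\log f'\,d\mu$. Slow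 recurrence: for $\delta>0$ let $\operatorname{dist}_\delta(x,c)=|x-c|$ if $|x-c|\le\delta$ and $\operatorname{dist}_\delta(x,c)=1$ otherwise. A set $\Lambda\subset[0,1]$ satisfies the slow recurrence condition to $c$ if for each $\epsilon>0$ there is $\delta>0$ such that $\limsup_{n\to\infty}\frac1n\sum_{j=0}^{n-1}-\log\operatorname{dist}_\delta(f^j(x),c)\le\epsilon$ for every $x\in\Lambda$. An ergodic $f$-invariant probability $\mu$ satisfies the slow recurrence condition if there is a set $\Lambda$ satisfying the slow recurrence condition to $c$ with $\mu(\Lambda)=1$. *)

(* Defs.v *)
From HB Require Import structures.
From mathcomp Require Import all_boot all_order all_algebra.
From mathcomp Require Import all_classical all_reals all_analysis.

Set Implicit Arguments.
Unset Strict Implicit.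
Unset Printing Implicit Defensive.

Import Order.TTheory GRing.Theory Num.Theory.
Import numFieldNormedType.Exports.

Local Open Scope classical_set_scope.
Local Open Scope ring_scope.

Section Smoothness.
Context {R : realType}.
Implicit Types (D A B : set R) (f g phi : R -> R) (x : R).

(* Derivatives are taken relative to the domain [D]: they are one-sided at the
   endpoints of an interval, and insensitive to the values of [f] off [D]. *)
Definition slope f x : R -> R := fun y => (f y - f x) / (y - x).

Definition derivable_within D f x : Prop :=
  cvg (slope f x y @[y --> within D x^']).

Definition derive_within D f x : R :=
  lim (slope f x y @[y --> within D x^']).

Definition locally_holder D g : Prop :=
  forall x, D x -> exists U : set R, exists gamma K : R,
    [/\ nbhs x U, 0 < gamma <= 1 &
      forall y z, (D `&` U) y -> (D `&` U) z ->
        `|g y - g z| <= K * `|y - z| `^ gamma].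

Definition C1plus D f : Prop :=
  [/\ forall x, D x -> derivable_within D f x,
      {within D, continuous (derive_within D f)} &
      locally_holder D (derive_within D f)].

Definition C1plus_diffeo A B phi : Prop :=
  exists psi : R -> R,
    [/\ set_fun A B phi, set_fun B A psi,
        forall x, A x -> psi (phi x) = x,
        forall y, B y -> phi (psi y) = y &
        C1plus A phi /\ C1plus B psi].

End Smoothness.

Section LorenzMap.
Context {R : realType}.
Implicit Types (c : R) (f : R -> R).

Definition lorenz_dom c : set R := `[0, 1] `\ c.

(* A map [0,1] \ {c} -> [0,1] is represented by a total function [f : R -> R]
   whose values off [lorenz_dom c], in particular [f c], are irrelevant. *)
Record expanding_lorenz c f : Prop := {
  lorenz_c01 : 0 < c < 1;
  lorenz_fun : set_fun (lorenz_dom c) `[0, 1] f;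
  lorenz_C1plus : C1plus (lorenz_dom c) f;
  lorenz_f0 : f 0 = 0;
  lorenz_f1 : f 1 = 1;
  lorenz_expanding : exists2 sigma : R, 1 < sigma &
    forall x, lorenz_dom c x -> sigma <= derive_within (lorenz_dom c) f x;
  lorenz_deriv_left :
    derive_within (lorenz_dom c) f x @[x --> c^'-] --> +oo;
  lorenz_deriv_right :
    derive_within (lorenz_dom c) f x @[x --> c^'+] --> +oo
}.

Definition non_flat c f : Prop :=
  exists alpha beta d0 d1 : R, exists phi0 phi1 : R -> R,
    [/\ [/\ 0 < alpha < 1, 0 < beta < 1, 0 <= d0 <= 1 & 0 <= d1 <= 1],
        C1plus_diffeo `[0, c] `[0, d0 `^ alpha^-1] phi0,
        C1plus_diffeo `[c, 1] `[0, d1 `^ beta^-1] phi1,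
        [/\ phi0 c = 0, phi1 c = 0,
            phi0 0 = d0 `^ alpha^-1 & phi1 1 = d1 `^ beta^-1] &
        (forall x, 0 <= x < c -> f x = d0 - phi0 x `^ alpha) /\
        (forall x, c < x <= 1 -> f x = 1 - d1 + phi1 x `^ beta)].

(* For an expanding Lorenz map, the points of [0,1] whose orbit meets [c]
   within [n] steps form a finite set, so these one-sided limits do not depend
   on [f c]. *)
Definition iter_left c f (n : nat) : R := lim (iter n f x @[x --> c^'-]).
Definition iter_right c f (n : nat) : R := lim (iter n f x @[x --> c^'+]).

Local Open Scope ereal_scope.

(* [lne 0 = -oo], so that [neglog 0 = +oo]. *)
Definition neglog (x : R) : \bar R := - lne x%:E.

Definition critical_average c (p : nat -> R) (n : nat) : \bar R :=
  (n%:R^-1)%:E * \sum_(1 <= j < n.+1) neglog `|p j - c|%R.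

Definition trunc_dist c (delta x : R) : R :=
  if (`|x - c| <= delta)%R then `|x - c|%R else 1%R.

(* If the orbit of [x] reaches [c], then the corresponding term is [+oo] and
   none is [-oo], so the limsup is [+oo] whatever the value of [f c]. *)
Definition slow_recurrence c f (Lambda : set R) : Prop :=
  forall epsilon : R, (0 < epsilon)%R ->
  exists2 delta : R, (0 < delta)%R &
    forall x, Lambda x ->
      limn_esup (fun n : nat => (n%:R^-1)%:E *
        \sum_(0 <= j < n) neglog (trunc_dist c delta (iter j f x)))
      <= epsilon%:E.

Definition lorenz_preimage c f (B : set R) : set R :=
  lorenz_dom c `&` f @^-1` B.

(* Borel probabilities on [0,1] are the Borel probabilities on [R] that give
   [0,1] full mass. *)
Definition invariant_prob c f (mu : probability (measurableTypeR R) R) : Prop :=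
  mu [set` `[0%R, 1%R]] = 1 /\
  forall B : set (measurableTypeR R), measurable B -> B `<=` [set` `[0%R, 1%R]] ->
    mu (lorenz_preimage c f B) = mu B.

Definition ergodic c f (mu : probability (measurableTypeR R) R) : Prop :=
  forall B : set (measurableTypeR R), measurable B -> B `<=` [set` `[0%R, 1%R]] ->
    lorenz_preimage c f B = B -> mu B = 0 \/ mu B = 1.

Definition slow_recurrence_prob c f
    (mu : probability (measurableTypeR R) R) : Prop :=
  exists Lambda : set (measurableTypeR R),
    [/\ measurable Lambda, Lambda `<=` [set` `[0%R, 1%R]],
        slow_recurrence c f Lambda & mu Lambda = 1].

(* The integrand is only defined off [c], which is null for every invariant
   probability. *)
Definition lyapunov_exponent c f
    (mu : probability (measurableTypeR R) R) : \bar R :=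
  \int[mu]_(x in lorenz_dom c) (ln (derive_within (lorenz_dom c) f x))%:E.

End LorenzMap.

(* Main.v *)
Require Import Defs.
From HB Require Import structures.
From mathcomp Require Import all_boot all_order all_algebra.
From mathcomp Require Import all_classical all_reals all_analysis.
From mathcomp Require Import measurable_realfun ring lra.

Set Implicit Arguments.
Unset Strict Implicit.
Unset Printing Implicit Defensive.

Import Order.TTheory GRing.Theory Num.Theory.
Import numFieldNormedType.Exports.

Local Open Scope classical_set_scope.
Local Open Scope ring_scope.

(** The idea is to compare an orbit that passes close to [c] with the orbit of a
    critical value. Write [l x = - ln `|x - c|]. Non-flatness says that on each
    side of [c] the map is a power [alpha] of a bi-Lipschitz function, which
    gives two estimates with constants [K] and [a] ([lorenz_estimates]): the
    image of [x] is within [K * `|x - c| `^ a] of the one-sided critical value,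
    and [`|f y - f z| <= K * `|y - z| / `|z - c|] for [y], [z] on the same side.

    Let [w j] be the orbit of the critical value on the side of [x]. The
    hypothesis on the critical averages forces this orbit to avoid [c], so that
    [w j.+1 = f (w j)], and it gives [\sum_(i < n) l (w i) <= M * n]
    ([critical_orbit]). As long as the orbit of [f x] stays bound to [w], that
    is, closer to [w i] than half the distance of [w i] to [c], the second
    estimate bounds the growth of the gap by the exponential of a partial sum of
    [ln K + l (w i)]. If the binding breaks at time [p], the gap has grown from
    [K * `|x - c| `^ a] to half the distance from [w p.-1] to [c]; hence
    [a * l x] is at most a constant times [p] ([bound_growth], [free_block]).
    While it lasts, [l] along the orbit of [f x] is at most [l (w i) + ln 2].
    So every orbit that avoids [c] splits into blocks on which the Birkhoff sum
    of [l] is at most [C] times the length of the block, up to one last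
    unfinished block; truncating [l] at [B], the sum of [n] terms is at most
    [C * n + B] ([birkhoff_sum_min_le]).

    Integrating this bound against an invariant probability, dividing by [n] and
    letting first [n] and then [B] tend to infinity gives [C] as a bound for the
    integral of [l] ([integral_le_of_birkhoff_sum_min]). Since
    [f' x <= K / `|x - c|], the Lyapunov exponents are at most [ln K + C].

    For slow recurrence, the integral of [l] over the [delta]-neighbourhood of
    [c] tends to 0 with [delta]. It remains to bound the upper limit of the
    Birkhoff averages of [g >= 0] by any [t] above its integral, for an ergodic
    measure ([ergodic_birkhoff_sum_le]). The set where [\sum_(i < n) g - n * t]
    is bounded in [n] is exactly invariant, so its measure is 0 or 1; measure 0
    is excluded by the block argument of [integral_ge_of_sublinear_time]. *)

(** * Birkhoff sums and relative derivatives *)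

Lemma birkhoff_sum_split {X : Type} {R : zmodType} (T : X -> X) (g : X -> R)
    (n p : nat) (x : X) : (p <= n)%N ->
  \sum_(i < n) g (iter i T x) =
  \sum_(i < p) g (iter i T x) + \sum_(i < n - p) g (iter i T (iter p T x)).
Proof.
move=> pn; rewrite -(big_mkord predT (fun i => g (iter i T x))).
rewrite (@big_cat_nat _ _ _ p)//= big_mkord; congr (_ + _).
rewrite -{1}(add0n p) big_addn big_mkord.
by apply: eq_bigr => i _; rewrite iterD.
Qed.

Section Calculus.
Context {R : realType}.
Implicit Types (D : set R) (f phi : R -> R).

Lemma derivable_withinP D phi x :
  derivable_within D phi x -> forall e, 0 < e ->
  exists2 d, 0 < d & forall y, D y -> `|y - x| < d -> y != x ->
    `|derive_within D phi x - slope phi x y| < e.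
Proof.
move=> h e e0; have /cvgrPdist_lt/(_ _ e0) := h.
rewrite /within/= => -[d /= d0 H]; exists d => // y Dy xy yx.
by apply: H => //=; rewrite distrC.
Qed.

Lemma derivable_within_continuous D phi :
  (forall x, D x -> derivable_within D phi x) -> {within D, continuous phi}.
Proof.
move=> h; apply/subspace_continuousP => x Dx; apply/cvgrPdist_lt => e e0.
have [d d0 H] := derivable_withinP (h x Dx) ltr01.
set l := derive_within D phi x in H.
pose K := `|l| + 1; have K0 : 0 < K by rewrite ltr_wpDl.
exists (Num.min d (e / K)) => /=; first by rewrite lt_min d0 divr_gt0.
move=> y /=; rewrite lt_min => /andP[yd ye] Dy.
have [->|yx] := eqVneq y x; first by rewrite subrr normr0.
have yx0 : 0 < `|y - x| by rewrite normr_gt0 subr_eq0.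
have := H y Dy; rewrite distrC => /(_ yd yx) hs.
have {}hs : `|slope phi x y| < K.
  by rewrite -(subKr l (slope phi x y)) (le_lt_trans (ler_normB _ _))// /K ltrD2l.
rewrite distrC (_ : phi y - phi x = slope phi x y * (y - x)); last first.
  by rewrite /slope mulfVK// subr_eq0.
rewrite normrM (lt_trans (y := K * `|y - x|))// ?ltr_pM2r//.
by rewrite mulrC -ltr_pdivlMr// distrC.
Qed.

Lemma derive_within_is_derive D phi x : nbhs x D ->
  derivable_within D phi x -> is_derive x 1 phi (derive_within D phi x).
Proof.
move=> nD dx.
have H : h^-1 *: ((phi \o shift x) (h *: (1:R)) - phi x) @[h --> 0^'] -->
    derive_within D phi x.
  apply/cvgrPdist_lt => e e0.
  have [d d0 H] := derivable_withinP dx e0.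
  case: nD => r /= r0 rD.
  exists (Num.min d r) => /=; first by rewrite lt_min d0.
  move=> h /=; rewrite sub0r normrN lt_min => /andP[hd hr] h0.
  have -> : h^-1 *: (phi (h *: (1:R) + x) - phi x) = slope phi x (h + x).
    by rewrite /slope addrK scaler1 [RHS]mulrC.
  apply: H; rewrite ?addrK//.
    by apply: rD => /=; rewrite opprD addrCA subrr addr0 normrN.
  by rewrite -subr_eq0 addrK.
apply: DeriveDef; first by apply/cvg_ex; exists (derive_within D phi x).
exact: cvg_lim.
Qed.

(** The relative derivative is bounded on the compact interval; the mean value
    theorem applies because it agrees with the usual derivative in the interior. *)
Lemma C1plus_lipschitz (a b : R) phi : a < b -> C1plus `[a, b] phi ->
  exists2 K : R, 0 < K &
    forall y z, y \in `[a, b] -> z \in `[a, b] -> `|phi y - phi z| <= K * `|y - z|.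
Proof.
move=> ab [dphi cphi _].
have := compact_bounded (continuous_compact cphi (segment_compact (a:=a) (b:=b))).
move=> [M [_ HM]].
pose K := `|M| + 1.
have MK : M < K by rewrite /K (le_lt_trans (ler_norm _))// ltrDl.
have {}HM x : x \in `[a, b] -> `|derive_within `[a, b] phi x| <= K.
  by move=> xab; apply: (HM _ MK); exists x.
exists K; first by rewrite ltr_wpDl.
suff H y z : y \in `[a, b] -> z \in `[a, b] -> y < z ->
    `|phi z - phi y| <= K * `|z - y|.
  move=> y z yab zab; case: (ltgtP y z) => [yz|zy|->].
  - by rewrite distrC (distrC y); exact: H.
  - exact: H.
  - by rewrite !subrr normr0 mulr0.
move=> yab zab yz.
have sub : `[y, z] `<=` `[a, b].
  move: yab zab; rewrite !in_itv/= => /andP[ay yb] /andP[az zb] x/=.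
  by rewrite !in_itv/= => /andP[yx xz]; rewrite (le_trans ay yx) (le_trans xz zb).
have [||x xyz ->] := @MVT R phi (derive_within `[a, b] phi) y z yz.
- move=> x; rewrite in_itv/= => /andP[yx xz]; apply: derive_within_is_derive.
    move: yab zab; rewrite !in_itv/= => /andP[ay yb] /andP[az zb].
    have xab : x \in `]a, b[.
      by rewrite in_itv/= (le_lt_trans ay yx) (lt_le_trans xz zb).
    by apply: filterS (near_in_itvoo xab) => u; exact: subset_itv_oo_cc.
  by apply: dphi; apply: sub => /=; rewrite in_itv/= !ltW.
- by apply: (continuous_subspaceW sub); exact: derivable_within_continuous.
- rewrite normrM ler_wpM2r//; apply: HM; apply: sub.
  by move: xyz => /=; rewrite !in_itv/= => /andP[? ?]; rewrite !ltW.
Qed.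

(** A secant bound valid for [s] on either side of [t]: [u `^ a] is [u] times
    [u `^ (a - 1)], and the second factor is nonincreasing in [u]. *)
Lemma powR_sub_le (a s t : R) : 0 < a < 1 -> 0 < s -> 0 <= t ->
  `|s `^ a - t `^ a| <= `|s - t| * s `^ (a - 1).
Proof.
move=> /andP[a0 a1] s0 t0.
have E u : 0 < u -> u `^ a = u * u `^ (a - 1).
  by move=> u0; rewrite -{2}(powRr1 (ltW u0)) -powRD ?gt_eqF ?implybT// subrKC.
have an : a - 1 <= 0 by lra.
have le u w : 0 < u -> u <= w -> w `^ (a - 1) <= u `^ (a - 1).
  move=> u0 uw; rewrite -(opprB 1 a) !powRN lef_pV2 ?posrE ?powR_gt0 ?(lt_le_trans u0 uw)//.
  by apply: ge0_ler_powR => //; rewrite ?nnegrE; lra.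
rewrite (E s s0); set q := s `^ (a - 1).
have q0 : 0 < q by rewrite powR_gt0.
have [->|tn0] := eqVneq t 0.
  by rewrite powR0 ?gt_eqF// !subr0 normrM (gtr0_norm q0).
have {tn0}t0 : 0 < t by rewrite lt_neqAle eq_sym tn0.
rewrite (E t t0); have [st|ts] := leP s t.
  rewrite distrC ger0_norm; last first.
    by rewrite subr_ge0 /q -!E// ge0_ler_powR ?nnegrE// ltW.
  by rewrite distrC ger0_norm ?subr_ge0// mulrBl lerB// ler_pM2l// le.
rewrite !ger0_norm ?subr_ge0 ?(ltW ts)//; last first.
  by rewrite /q -!E// ge0_ler_powR ?nnegrE// ltW.
by rewrite mulrBl lerB// ler_pM2l// le// ltW.
Qed.
End Calculus.

(** * Powers of diffeomorphisms *)

Section Branch.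
Context {R : realType}.
Implicit Types (a b c alpha B : R) (f phi : R -> R).

(** The two estimates for the [alpha]-th power of a diffeomorphism vanishing at
    [c]. The second is relative to the point [z]: with [K'] a common Lipschitz
    constant of [phi] and of its inverse, [phi z] is at least [`|z - c| / K'],
    so that [phi z `^ (alpha - 1)] is at most [K' / `|z - c|]. *)
Lemma diffeo_power_estimates a b c alpha B phi :
  a < b -> b - a <= 1 -> c \in `[a, b] -> 0 < alpha < 1 ->
  C1plus_diffeo `[a, b] `[0, B] phi -> phi c = 0 ->
  exists2 K : R, 1 <= K &
    (forall x, x \in `[a, b] -> phi x `^ alpha <= K * `|x - c| `^ alpha) /\
    (forall y z, y \in `[a, b] -> z \in `[a, b] -> z != c ->
      `|phi y `^ alpha - phi z `^ alpha| <= K * (`|y - z| / `|z - c|)).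
Proof.
move=> ab ba1 cab al01 [psi [phiAB psiBA psiK _ [C1phi C1psi]]] phic.
have [al0 al1] := andP al01.
have phi_ge0 x : x \in `[a, b] -> 0 <= phi x.
  by move=> /phiAB; rewrite /= in_itv/= => /andP[].
have phi_in x : x \in `[a, b] -> phi x \in `[0, B].
  by move=> /phiAB.
have B0 : 0 < B.
  (* If [B <= 0] then [phi] vanishes at both ends, against injectivity. *)
  rewrite ltNge; apply/negP => B0.
  have phi0 x : x \in `[a, b] -> phi x = 0.
    move=> xab; apply/eqP; rewrite eq_le phi_ge0// andbT.
    by have := phi_in _ xab; rewrite in_itv/= => /andP[_ /le_trans]; apply.
  have aab : a \in `[a, b] by rewrite in_itv/= lexx ltW.
  have bab : b \in `[a, b] by rewrite in_itv/= lexx ltW.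
  have := psiK _ bab; rewrite phi0// -(phi0 a)// psiK// => eab.
  by rewrite eab ltxx in ab.
have [K1 K10 L1] := C1plus_lipschitz ab C1phi.
have [K2 K20 L2] := C1plus_lipschitz B0 C1psi.
pose K := K1 + K2 + 1.
have K1K : K1 <= K by rewrite /K; lra.
have K2K : K2 <= K by rewrite /K; lra.
have Kge1 : 1 <= K by rewrite /K; lra.
have K0 : 0 < K by lra.
have Llo z : z \in `[a, b] -> `|z - c| / K <= phi z.
  move=> zab; rewrite ler_pdivrMr// mulrC.
  have := L2 _ _ (phi_in _ zab) (phi_in _ cab).
  rewrite !psiK// phic subr0 (ger0_norm (phi_ge0 _ zab)) => /le_trans; apply.
  by rewrite ler_wpM2r ?phi_ge0.
have dist1 z : z \in `[a, b] -> `|z - c| <= 1.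
  move: cab; rewrite !in_itv/= => /andP[ac cb] /andP[az zb].
  by rewrite ler_norml; apply/andP; split; lra.
exists (K ^+ 2); first by rewrite exprn_ege1.
split=> [x xab|y z yab zab zc].
  have le1 : phi x <= K * `|x - c|.
    have := L1 _ _ xab cab; rewrite phic subr0 (ger0_norm (phi_ge0 _ xab)).
    by move=> /le_trans; apply; rewrite ler_wpM2r.
  have : phi x `^ alpha <= (K * `|x - c|) `^ alpha.
    by apply: ge0_ler_powR; rewrite ?nnegrE ?phi_ge0 ?mulr_ge0//; lra.
  move=> /le_trans; apply; rewrite powRM ?ler_wpM2r ?powR_ge0 ?(ltW K0)//.
  apply: (@le_trans _ _ (K `^ 2)); first by rewrite ler_powR//; lra.
  by rewrite powR_mulrn// ltW.
have zc0 : 0 < `|z - c| by rewrite normr_gt0 subr_eq0.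
set w := `|z - c| / K.
have w0 : 0 < w by rewrite divr_gt0.
have w1 : w <= 1 by rewrite ler_pdivrMr// mul1r (le_trans (dist1 _ zab)).
have phiz0 : 0 < phi z by rewrite (lt_le_trans w0)// Llo.
rewrite distrC; apply: le_trans (powR_sub_le al01 phiz0 (phi_ge0 _ yab)) _.
have h1 : phi z `^ (alpha - 1) <= w^-1.
  rewrite -(opprB 1 alpha) powRN lef_pV2 ?posrE ?powR_gt0//.
  apply: (@le_trans _ _ (w `^ (1 - alpha))).
    by rewrite -{1}(powRr1 (ltW w0)) ger_powR ?w0 ?w1//; lra.
  by apply: ge0_ler_powR; rewrite ?nnegrE ?Llo ?(ltW w0) ?(ltW phiz0)//; lra.
apply: (@le_trans _ _ (K1 * `|z - y| * w^-1)).
  by apply: ler_pM; rewrite ?powR_ge0// L1.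
rewrite /w invf_div (distrC z y) mulrA (mulrAC _ `|y - z|) mulrA ler_pM2r ?invr_gt0//.
by rewrite expr2 ler_wpM2r// ler_wpM2r// ltW.
Qed.
End Branch.

(** * Estimates for the map and the critical orbits *)

Section Lorenz.
Context {R : realType}.
Implicit Types (c : R) (f : R -> R).

(** The numbers [v0] and [v1] are the left and right critical values. The
    exponent [a] is the smaller one of the two branches, which is harmless as
    distances are at most 1. *)
Lemma lorenz_estimates c f : expanding_lorenz c f -> non_flat c f ->
  exists v0 v1 K a : R,
  [/\ 1 <= K, 0 < a < 1,
    forall x, lorenz_dom c x ->
      `|f x - (if x < c then v0 else v1)| <= K * `|x - c| `^ a &
    forall y z, lorenz_dom c y -> lorenz_dom c z -> (y < c) = (z < c) ->
      `|f y - f z| <= K * (`|y - z| / `|z - c|)].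
Proof.
move=> Lf [al [be [d0 [d1 [phi0 [phi1]]]]]].
move=> [[al01 be01 d001 d101] D0 D1 [phi0c phi1c _ _] [fl fr]].
have /andP[c0 c1] := lorenz_c01 Lf.
have c0c : c \in `[0, c] by rewrite in_itv/= lexx ltW.
have cc1 : c \in `[c, 1] by rewrite in_itv/= lexx ltW.
have [|K0 K01 [E0 S0]] := diffeo_power_estimates c0 _ c0c al01 D0 phi0c; first by lra.
have [|K1 K11 [E1 S1]] := diffeo_power_estimates c1 _ cc1 be01 D1 phi1c; first by lra.
have KK0 : K0 <= K0 + K1 by lra.
have KK1 : K1 <= K0 + K1 by lra.
have side x : lorenz_dom c x -> (x < c /\ 0 <= x) \/ (c < x <= 1 /\ (x < c) = false).
  move=> [/=]; rewrite in_itv/= => /andP[x0 x1] xc.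
  case: (ltgtP x c) => xc'; [by left|by right; rewrite x1|by rewrite xc' in xc].
exists d0, (1 - d1), (K0 + K1), (Num.min al be).
have m01 : 0 < Num.min al be < 1.
  by rewrite lt_min gt_min; move: al01 be01 => /andP[-> ->] /andP[-> _].
have pmin x e K : 0 <= x <= 1 -> 0 <= K <= K0 + K1 -> Num.min al be <= e ->
    K * x `^ e <= (K0 + K1) * x `^ (Num.min al be).
  move=> /andP[x0 x1] /andP[Kp KK] me.
  apply: ler_pM => //; first exact: powR_ge0.
  have [->|xn0] := eqVneq x 0.
    case/andP: m01 => m0 _.
    by rewrite !powR0 ?gt_eqF// (lt_le_trans m0).
  by rewrite ger_powR// lt_neqAle eq_sym xn0 x0.
split => //; first by lra.
- move=> x /side[[xc x0]|[/andP[cx x1] ->]].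
    have xi : x \in `[0, c] by rewrite in_itv/= x0 ltW.
    rewrite xc fl ?x0// addrAC subrr add0r normrN ger0_norm ?powR_ge0//.
    apply: le_trans (E0 _ xi) _; apply: pmin; last by rewrite ge_min lexx.
      by rewrite normr_ge0 ler_norml; apply/andP; split; lra.
    by rewrite KK0 andbT; lra.
  have xi : x \in `[c, 1] by rewrite in_itv/= x1 ltW.
  rewrite fr ?cx// addrAC subrr add0r ger0_norm ?powR_ge0//.
  apply: le_trans (E1 _ xi) _; apply: pmin; last by rewrite ge_min lexx orbT.
    by rewrite normr_ge0 ler_norml; apply/andP; split; lra.
  by rewrite KK1 andbT; lra.
- move=> y z /side[[yc y0]|[/andP[cy y1] ->]] /side[[zc z0]|[/andP[cz z1] ->]];
    rewrite ?yc ?zc// => _.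
    have yi : y \in `[0, c] by rewrite in_itv/= y0 ltW.
    have zi : z \in `[0, c] by rewrite in_itv/= z0 ltW.
    rewrite !fl ?y0 ?z0// opprB (addrC (phi0 z `^ al)) addrACA subrr add0r addrC distrC.
    apply: le_trans (S0 _ _ yi zi _) _; first by rewrite lt_eqF.
    by rewrite ler_wpM2r// mulr_ge0// invr_ge0.
  have yi : y \in `[c, 1] by rewrite in_itv/= y1 ltW.
  have zi : z \in `[c, 1] by rewrite in_itv/= z1 ltW.
  rewrite !fr ?cy ?cz// opprD addrACA subrr add0r.
  apply: le_trans (S1 _ _ yi zi _) _; first by rewrite gt_eqF.
  by rewrite ler_wpM2r// mulr_ge0// invr_ge0.
Qed.

Lemma limn_esup_lty_bounded (u : (\bar R)^nat) : (limn_esup u < +oo)%E ->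
  exists M : R, exists N, forall n, (N <= n)%N -> (u n <= M%:E)%E.
Proof.
move=> /ereal_inf_lt[_ [V [N _ NV] <-]] supV.
exists (fine (Order.max 0%E (ereal_sup [set u x | x in V]))), N => n Nn.
have un : (u n <= ereal_sup [set u x | x in V])%E.
  by apply: ereal_sup_ubound; exists n => //; apply: NV.
rewrite fineK ?le_max ?un ?orbT//.
by rewrite ge0_fin_numE ?le_max ?lexx// gt_max ltry.
Qed.

Lemma neglogE (y : R) : 0 < y -> neglog y = (- ln y)%:E.
Proof. by move=> y0; rewrite /neglog lne_EFin// EFinN. Qed.

Lemma neglog_neqNy (y : R) : neglog y != -oo%E.
Proof.
have [y0|y0] := ltP 0 y; first by rewrite neglogE.
by rewrite /neglog le0_lneNy// lee_fin.
Qed.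

(** With [F] one of the filters [c^'-], [c^'+], [p n] is the [n]-th point of the
    one-sided critical orbit, [p 1] being the critical value [v]. *)
Lemma critical_orbit c f (F : set_system R) (v : R) :
  ProperFilter F -> expanding_lorenz c f -> F (lorenz_dom c) ->
  f x @[x --> F] --> v ->
  let p (n : nat) : R := lim (iter n f x @[x --> F]) in
  (limn_esup (critical_average c p) < +oo)%E ->
  [/\ p 1%N = v, forall j, lorenz_dom c (p j.+1),
    forall j, p j.+2 = f (p j.+1) &
    exists2 M : R, 0 <= M &
      forall n, \sum_(i < n) - ln `|p i.+1 - c| <= M * n%:R].
Proof.
move=> FF Lf Fdom Fv p /limn_esup_lty_bounded[M [N HM]].
have p1 : p 1%N = v by apply/cvg_lim.
have sumN (s : seq nat) : (\sum_(i <- s) neglog `|p i - c|%R)%E != -oo%E.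
  elim/big_ind : _ => //; last by move=> i _; exact: neglog_neqNy.
  by move=> [x||] [y||].
have pc j : (0 < j)%N -> p j != c.
  (* A visit to [c] would make all averages from that time on infinite. *)
  move=> j0; apply/eqP => pjc.
  have := HM (maxn N j) (leq_maxl _ _).
  rewrite /critical_average (bigD1_seq j) /= ?iota_uniq//; last first.
    by rewrite mem_index_iota j0 ltnS leq_maxr.
  rewrite pjc subrr normr0 {1}/neglog le0_lneNy//= addye; last first.
    rewrite -big_filter; exact: sumN.
  by rewrite gt0_muley ?lte_fin ?invr_gt0 ?ltr0n ?leye_eq// leq_max j0 orbT.
have domP x : lorenz_dom c x -> 0 <= x <= 1 /\ x != c.
  by move=> [/=]; rewrite in_itv/= => ? /eqP.
have fcont := derivable_within_continuous (let: And3 h _ _ := lorenz_C1plus Lf in h).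
(* Since [p j.+1] differs from [c], so do the nearby points of the orbits. *)
have lands j : iter j.+1 f x @[x --> F] --> p j.+1 ->
    (\forall x \near F, `[0, 1]%classic (iter j.+1 f x)) ->
    lorenz_dom c (p j.+1) /\ \forall x \near F, lorenz_dom c (iter j.+1 f x).
  move=> cj nj; split.
    split; last by apply/eqP; exact: pc.
    exact: (closed_cvg _ (@itv_closed _ R 0 1) nj _ cj).
  have nc : nbhs (p j.+1) (~` [set c]).
    apply: open_nbhs_nbhs; split; first by apply: closed_openC; exact: closed_eq.
    by apply/eqP; exact: pc.
  by apply: filterS2 nj (cj _ nc) => x ? ?; split.
have next j : iter j.+1 f x @[x --> F] --> p j.+1 -> lorenz_dom c (p j.+1) ->
    (\forall x \near F, lorenz_dom c (iter j.+1 f x)) ->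
    iter j.+2 f x @[x --> F] --> f (p j.+1).
  move=> cj dj ndj; move/subspace_continuousP : fcont => /(_ _ dj) cf.
  apply: cvg_trans cf => A /= nA; rewrite /nbhs/=.
  by apply: filterS2 ndj (cj _ nA) => x dx; exact.
have step j : iter j.+1 f x @[x --> F] --> p j.+1 /\
    (\forall x \near F, `[0, 1]%classic (iter j.+1 f x)).
  elim: j => [|j [cj nj]].
    split; first by rewrite p1.
    by apply: filterS Fdom => x; exact: (lorenz_fun Lf).
  have [dj ndj] := lands _ cj nj.
  split; last by apply: filterS ndj => x; exact: (lorenz_fun Lf).
  have cf := next _ cj dj ndj.
  by rewrite /p (cvg_lim _ cf).
have dom j : lorenz_dom c (p j.+1) by have [cj nj] := step j; have [] := lands _ cj nj.
split=> // [j|].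
  have [cj nj] := step j; have [dj ndj] := lands _ cj nj.
  have cf := next _ cj dj ndj.
  by rewrite /p (cvg_lim _ cf).
have l0 i : 0 <= - ln `|p i.+1 - c|.
  rewrite oppr_ge0 ln_le0//; have [/andP[? ?] _] := domP _ (dom i).
  by have /andP[? ?] := lorenz_c01 Lf; rewrite ler_norml; apply/andP; split; lra.
have avg n : (N <= n)%N -> (0 < n)%N ->
    \sum_(i < n) - ln `|p i.+1 - c| <= M * n%:R.
  move=> Nn n0; have := HM _ Nn; rewrite /critical_average big_add1/= big_mkord.
  rewrite (eq_bigr (fun i : 'I_n => (- ln `|p i.+1 - c|)%:E)) => [|i _]; last first.
    by rewrite neglogE// normr_gt0 subr_eq0 pc.
  by rewrite sumEFin -EFinM lee_fin mulrC ler_pdivrMr ?ltr0n.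
(* The bound by [M] only holds for [n >= N]; for smaller [n], the sum up to
   [N] is used, the terms being nonnegative. *)
exists (`|M| * N.+1%:R) => [|n]; first by rewrite mulr_ge0.
have [->|n0] := posnP n; first by rewrite big_ord0 mulr0.
pose m := maxn N n; have mn : (n <= m)%N by rewrite leq_maxr.
apply: (@le_trans _ _ (\sum_(i < m) - ln `|p i.+1 - c|)).
  rewrite -(big_mkord predT (fun i => - ln `|p i.+1 - c|)).
  rewrite -(big_mkord predT (fun i => - ln `|p i.+1 - c|)).
  by rewrite (@big_cat_nat _ _ _ n 0%N m)//= lerDl sumr_ge0.
apply: le_trans (avg _ (leq_maxl _ _) (leq_trans n0 mn)) _.
apply: (@le_trans _ _ (`|M| * m%:R)); first by rewrite ler_wpM2r// ler_norm.
rewrite -mulrA ler_wpM2l// -natrM ler_nat geq_max leq_pmull// andbT.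
by rewrite (leq_trans (leqnSn N))// leq_pmulr.
Qed.
End Lorenz.

(** * Binding to the critical orbit *)

Section Binding.
Context {R : realType}.
Variables (c : R) (f : R -> R) (K a M : R).
Hypotheses (K1 : 1 <= K) (a01 : 0 < a < 1) (M0 : 0 <= M).
Hypothesis secant : forall y z, lorenz_dom c y -> lorenz_dom c z ->
  (y < c) = (z < c) -> `|f y - f z| <= K * (`|y - z| / `|z - c|).

Let l (x : R) := - ln `|x - c|.

Lemma bound_point (y w : R) : w != c -> `|y - w| < 2^-1 * `|w - c| ->
  l y <= l w + ln 2 /\ (y < c) = (w < c).
Proof.
move=> wc yw.
have wc0 : 0 < `|w - c| by rewrite normr_gt0 subr_eq0.
have h : 2^-1 * `|w - c| < `|y - c|.
  have : `|w - c| <= `|y - w| + `|y - c|.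
    by rewrite -(distrC w) (le_trans _ (ler_normD _ _))// addrA subrK.
  lra.
split.
  have : ln (2^-1 * `|w - c|) <= ln `|y - c|.
    by rewrite ler_ln ?posrE ?mulr_gt0 ?invr_gt0// ?(ltW h)// (lt_trans _ h)// mulr_gt0.
  rewrite lnM ?posrE// lnV ?posrE// /l; lra.
move: yw wc0; case: (ltgtP w c) wc => // wc _.
  rewrite (ler0_norm (x := w - c)) ?ltr_norml; last lra.
  by move=> /andP[? ?] _; lra.
rewrite (ger0_norm (x := w - c)) ?ltr_norml; last lra.
by move=> /andP[? ?] _; apply/negbTE; rewrite -leNgt; lra.
Qed.

(** The sequence [w] is the orbit of the critical value on the side of [x]. *)
Variables (x : R) (w : nat -> R).
Hypothesis domx : forall j, lorenz_dom c (iter j f x).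
Hypothesis domw : forall j, lorenz_dom c (w j).
Hypothesis wS : forall j, w j.+1 = f (w j).
Hypothesis w0 : `|f x - w 0| <= K * `|x - c| `^ a.
Hypothesis wM : forall n, \sum_(i < n) l (w i) <= M * n%:R.

(** The orbit of [f x] is bound to [w] at time [i] when it is closer to [w i]
    than half the distance of [w i] to [c]; it is then on the same side of [c]
    as [w i], and at least half as far from [c]. *)
Let bound i := `|iter i.+1 f x - w i| < 2^-1 * `|w i - c|.

Let domN z : lorenz_dom c z -> 0 < `|z - c|.
Proof. by move=> [_ /eqP zc]; rewrite normr_gt0 subr_eq0. Qed.

(** The gap is multiplied at each bound step by at most
    [K / `|w k - c| = expR (ln K + l (w k))]. *)
Lemma bound_growth k : (forall i, (i < k)%N -> bound i) ->
  `|iter k.+1 f x - w k| <=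
  expR (k.+1%:R * ln K + \sum_(i < k) l (w i) - a * l x).
Proof.
have K0 : 0 < K := lt_le_trans ltr01 K1.
have x0 : 0 < `|x - c| := domN (domx 0).
elim: k => [_|k IH bk].
  rewrite big_ord0 mul1r addr0 mulrN opprK expRD lnK ?posrE//.
  by move: w0; rewrite /powR gt_eqF.
have h := IH (fun i ik => bk i (ltnW ik)).
have wc0 := domN (domw k).
rewrite iterS wS; apply: le_trans (secant (domx _) (domw _) _) _.
  by have [] := bound_point _ (bk k (ltnSn k)); first by case: (domw k) => _ /eqP.
rewrite big_ord_recr/=.
have -> : k.+2%:R * ln K + (\sum_(i < k) l (w i) + l (w k)) - a * l x =
  ln K + ((k.+1%:R * ln K + \sum_(i < k) l (w i) - a * l x) + l (w k)).
  by rewrite -[k.+2]add1n natrD; ring.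
rewrite expRD lnK ?posrE// ler_pM2l// expRD /l expRN lnK ?posrE//.
by rewrite ler_pM2r ?invr_gt0.
Qed.

(** A bound for the averages of [l] over blocks. The quotient by [a] accounts for
    [l x], and the rest for the points bound to [w]. *)
Let C := (ln K + ln 2 + M) / a + M + ln 2.

Let lnK0 : 0 <= ln K. Proof. exact: ln_ge0. Qed.
Let ln20 : 0 <= ln (2:R). Proof. by apply: ln_ge0; lra. Qed.

Lemma bound_sum k : (forall i, (i < k)%N -> bound i) ->
  \sum_(i < k) l (iter i.+1 f x) <= (M + ln 2) * k%:R.
Proof.
move=> bk; apply: (@le_trans _ _ (\sum_(i < k) (l (w i) + ln 2))).
  apply: ler_sum => i _.
  by have [] := bound_point _ (bk i (ltn_ord i)); first by case: (domw i) => _ /eqP.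
by rewrite big_split/= sumr_const card_ord mulrDl (mulr_natr (ln 2)) lerD//; exact: wM.
Qed.

(** If the binding first breaks at [k], the block of length [k.+1] starting at
    [x] has an average of [l] at most [C]. *)
Lemma free_block k : (forall i, (i < k)%N -> bound i) -> ~~ bound k ->
  \sum_(i < k.+1) l (iter i f x) <= C * k.+1%:R.
Proof.
have [a0 a1] := andP a01.
move=> bk; rewrite -leNgt => nbk.
have wc0 := domN (domw k).
have : ln (2^-1 * `|w k - c|) <= k.+1%:R * ln K + \sum_(i < k) l (w i) - a * l x.
  rewrite -[leRHS]expRK ler_ln ?posrE ?expR_gt0 ?mulr_gt0//.
  by rewrite (le_trans nbk)// bound_growth.
rewrite lnM ?posrE// lnV ?posrE// => h1.
have h2 := wM k.+1; rewrite big_ord_recr/= {2}/l in h2.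
have h3 := bound_sum bk.
rewrite big_ord_recl/=.
have h4 : l x <= (ln K + ln 2 + M) / a * k.+1%:R.
  rewrite mulrAC ler_pdivlMr// mulrC.
  have k1 : ln 2 <= ln 2 * k.+1%:R :> R by rewrite ler_peMr// ler1n.
  rewrite !mulrDl; move: h1 h2 k1; lra.
have h5 : (M + ln 2) * k%:R <= (M + ln 2) * k.+1%:R.
  by rewrite ler_wpM2l ?ler_nat// addr_ge0.
rewrite /C -addrA mulrDl lerD// (le_trans _ h5)//.
Qed.

(** Either a complete block fits in the first [n] steps, or the binding lasts
    throughout. In the second case the term [l x] is not controlled, and it is
    left out of the sum. *)
Lemma block_dichotomy n :
  (exists2 p, (0 < p <= n)%N & \sum_(i < p) l (iter i f x) <= C * p%:R) \/
  \sum_(1 <= i < n) l (iter i f x) <= C * n%:R.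
Proof.
have [[k kn bk]|nb] := pselect (exists2 k, (k < n)%N & ~~ bound k).
  left; have ek : exists k, ~~ bound k by exists k.
  case: (ex_minnP ek) => m bm mmin.
  exists m.+1; first by rewrite /= (leq_ltn_trans (mmin _ bk) kn).
  apply: free_block => // i im; apply: contraT => /mmin; by rewrite leqNgt im.
right; have [->|n0] := posnP n; first by rewrite big_geq// mulr0.
rewrite -(prednK n0) big_add1/= big_mkord.
apply: le_trans (bound_sum _) _.
  move=> i ilt; apply: contra_notT nb => nbi; exists i => //.
  by rewrite (ltn_trans ilt)// ltn_predL.
have [a0 a1] := andP a01.
have C0 : M + ln 2 <= C.
  by rewrite /C -addrA lerDr divr_ge0 ?(ltW a0)// !addr_ge0.
by apply: ler_pM => //; rewrite ?addr_ge0// ler_nat leqnSn.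
Qed.

End Binding.

(** * Measure-preserving transformations *)

Section MeasurePreserving.
Context {d : measure_display} {X : measurableType d} {R : realType}.
Variables (mu : probability X R) (T : X -> X).
Hypothesis mT : measurable_fun setT T.
Hypothesis muT : forall A, measurable A -> mu (T @^-1` A) = mu A.
Implicit Types (g : X -> R).

Lemma measurable_ltr g (r : R) : measurable_fun setT g ->
  measurable [set x | r < g x].
Proof.
move=> mg; have := mg measurableT `]r, +oo[%classic (measurable_itv _).
rewrite setTI; congr measurable.
by apply/seteqP; split => x; rewrite /= in_itv/= andbT.
Qed.

Lemma measurable_iter n : measurable_fun setT (iter n T).
Proof.
elim: n => [|n IH]; first exact: measurable_id.
by rewrite (_ : iter n.+1 T = T \o iter n T)//; exact: measurableT_comp.
Qed.

Lemma measurable_birkhoff_sum g n : measurable_fun setT g ->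
  measurable_fun setT (fun x => \sum_(i < n) g (iter i T x)).
Proof.
move=> mg; apply: measurable_sum => i.
by apply: (measurableT_comp mg); exact: measurable_iter.
Qed.

Lemma integral_iter (g : X -> \bar R) n : measurable_fun setT g ->
  (forall x, (0 <= g x)%E) ->
  (\int[mu]_x g (iter n T x) = \int[mu]_x g x)%E.
Proof.
move=> mg g0; elim: n => // n IH.
have mgn : measurable_fun setT (g \o iter n T).
  by apply: (measurableT_comp mg); exact: measurable_iter.
transitivity (\int[mu]_x ((g \o iter n T) \o T) x)%E.
  by apply: eq_integral => x _; rewrite /= -iterSr.
transitivity (\int[pushforward mu T]_x (g \o iter n T) x)%E.
  by rewrite ge0_integral_pushforward// => x _; exact: g0.
by rewrite -IH; apply: eq_measure_integral => A mA _; exact: muT.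
Qed.

Lemma integral_birkhoff_sum g n : measurable_fun setT g -> (forall x, 0 <= g x) ->
  (\int[mu]_x (\sum_(i < n) g (iter i T x))%:E = n%:R%:E * \int[mu]_x (g x)%:E)%E.
Proof.
move=> mg g0.
under eq_integral do rewrite -sumEFin.
rewrite ge0_integral_sum//; first last.
  by move=> i x _; rewrite lee_fin.
  move=> i; apply/measurable_EFinP; apply: (measurableT_comp mg).
  exact: measurable_iter.
rewrite (eq_bigr (fun=> \int[mu]_x (g x)%:E)%E) => [|i _]; last first.
  apply: (integral_iter (g := EFin \o g)); first exact/measurable_EFinP.
  by move=> x; rewrite lee_fin.
by rewrite sumr_const card_ord mule_natl.
Qed.

(** The hypothesis integrates to [n * \int min (g, B) <= C * n + B]. *)
Lemma integral_le_of_birkhoff_sum_min g (C : R) :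
  measurable_fun setT g -> (forall x, 0 <= g x) -> 0 <= C ->
  (\forall x \ae mu, forall (n : nat) (B : R), 0 <= B ->
     \sum_(i < n) Num.min (g (iter i T x)) B <= C * n%:R + B) ->
  (\int[mu]_x (g x)%:E <= C%:E)%E.
Proof.
move=> mg g0 C0 Hae.
pose gB (k : nat) (x : X) := Num.min (g x) k%:R.
have mgB k : measurable_fun setT (gB k) by exact: measurable_minr.
have gB0 k x : 0 <= gB k x by rewrite le_min g0 ler0n.
have gBC k : (\int[mu]_x (gB k x)%:E <= C%:E)%E.
  apply/lee_addgt0Pr => e e0.
  (* A length [n] for which the error [k / n] is at most [e]. *)
  pose n := (Num.bound (k%:R / e)).+1.
  have n0 : 0 < n%:R :> R by rewrite ltr0n.
  have kn : k%:R <= e * n%:R.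
    rewrite mulrC -ler_pdivrMr// (le_trans (ltW (archi_boundP _)))//.
      by rewrite divr_ge0// ltW.
    by rewrite ler_nat.
  have : (\int[mu]_x (\sum_(i < n) gB k (iter i T x))%:E <=
          \int[mu]_(x in setT) (C * n%:R + k%:R)%:E)%E.
    apply: ae_ge0_le_integral => //.
    - by move=> x _; rewrite lee_fin sumr_ge0.
    - by apply/measurable_EFinP; exact: measurable_birkhoff_sum.
    - by move=> x _; rewrite lee_fin addr_ge0// mulr_ge0.
    - by apply: filterS Hae => x Hx _; rewrite lee_fin; apply: Hx.
  rewrite integral_birkhoff_sum// integral_cst//= probability_setT mule1.
  rewrite muleC -lee_pdivlMr// => /le_trans; apply.
  rewrite -EFinM -EFinD lee_fin ler_pdivrMr// mulrDl.
  by rewrite lerD2l.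
have cv : ((\int[mu]_x (gB k x)%:E) @[k --> \oo] -->
    \int[mu]_x (g x)%:E)%E.
  have -> : (\int[mu]_x (g x)%:E = \int[mu]_x limn (fun k => (gB k x)%:E))%E.
    apply: eq_integral => x _; apply/esym/cvg_lim => //.
    apply: cvg_near_cst.
    near=> k; congr EFin; apply/min_idPl; near: k.
    exact: nbhs_infty_ger.
  apply: cvg_monotone_convergence => //.
  - by move=> k; exact/measurable_EFinP.
  - by move=> k x _; rewrite lee_fin.
  - move=> x _ k l kl; rewrite lee_fin /gB le_min ge_min lexx/= ge_min.
    by rewrite ler_nat kl orbT.
rewrite -(cvg_lim _ cv)//; apply: lime_le; first by apply/cvg_ex; eexists; exact: cv.
by near=> k; exact: gBC.
Unshelve. all: by end_near. Qed.

(** If almost every orbit has an initial block along which the average of [g]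
    exceeds [t], then so does, weakly, the integral. The points whose block is
    shorter than [N] form a set [E N], and on its complement [g] is increased by
    [t], so that one step is already a good block; the measure of this
    complement tends to 0. *)
Lemma integral_ge_of_sublinear_time g (t : R) :
  measurable_fun setT g -> (forall x, 0 <= g x) -> 0 <= t ->
  mu [set x | exists n, (n%:R * t < \sum_(i < n) g (iter i T x))] = 1%E ->
  (t%:E <= \int[mu]_x (g x)%:E)%E.
Proof.
move=> mg g0 t0 mu1.
have [->|] := eqVneq (\int[mu]_x (g x)%:E)%E +oo%E; first exact: leey.
rewrite -ltey => gfin.
pose E N := [set x | exists2 n, (n < N)%N & n%:R * t < \sum_(i < n) g (iter i T x)].
have mE N : measurable (E N).
  rewrite (_ : E N = \bigcup_(n in `I_N)
      [set x | n%:R * t < \sum_(i < n) g (iter i T x)]).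
    apply: bigcup_measurable => n _; apply: measurable_ltr.
    exact: measurable_birkhoff_sum.
  by apply/seteqP; split => x /= [n]; exists n.
pose g' N x := g x + t * \1_(~` E N) x.
have g'0 N x : 0 <= g' N x by rewrite addr_ge0// mulr_ge0.
have mg' N : measurable_fun setT (g' N).
  apply: measurable_funD => //; apply: measurable_funM => //.
  by apply: measurable_indic; exact: measurableC.
(* Good blocks are concatenated until at most [N] steps are left. *)
have block N n x : t * (n%:R - N%:R) <= \sum_(i < n) g' N (iter i T x).
  elim/ltn_ind: n x => n IH x.
  have [nN|Nn] := leqP n N.
    apply: (@le_trans _ _ 0); last exact: sumr_ge0.
    by rewrite mulr_ge0_le0// subr_le0 ler_nat.
  have [Ex|nEx] := pselect (E N x).
    have [p pN hp] := Ex.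
    have pn : (p <= n)%N by rewrite ltnW// (ltn_trans pN).
    have p0 : (0 < p)%N.
      by case: p hp {pN pn} => // hp; move: hp; rewrite big_ord0 mul0r ltxx.
    have ltnp : (n - p < n)%N by rewrite ltn_subrL p0 (leq_trans _ Nn).
    rewrite (birkhoff_sum_split _ _ _ pn); apply: le_trans (lerD _ (IH _ ltnp _)); last first.
      by apply: le_trans (ltW hp) _; apply: ler_sum => i _; rewrite lerDl mulr_ge0.
    by rewrite natrB//; lra.
  have n0 : (0 < n)%N by rewrite (leq_trans _ Nn).
  have ltn1 : (n - 1 < n)%N by rewrite ltn_subrL.
  rewrite (birkhoff_sum_split _ _ _ n0); apply: (@le_trans _ _ (t + t * ((n - 1)%:R - N%:R))).
    by rewrite natrB//; lra.
  apply: lerD; last exact: IH.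
  rewrite big_ord1 /= /g' indicE mem_set//= mulr1.
  by rewrite lerDr.
have intg' N : (\int[mu]_x (g' N x)%:E =
    \int[mu]_x (g x)%:E + t%:E * mu (~` E N))%E.
  have m1 : measurable_fun setT (\1_(~` E N) : X -> R).
    by apply: measurable_indic; exact: measurableC.
  under eq_integral do rewrite /g' EFinD EFinM.
  rewrite ge0_integralD//.
  - rewrite ge0_integralZl_EFin//; last exact/measurable_EFinP.
    by rewrite integral_indic ?setIT//; exact: measurableC.
  - by move=> x _; rewrite lee_fin.
  - exact/measurable_EFinP.
  - by move=> x _; rewrite -EFinM lee_fin mulr_ge0.
  - by apply: emeasurable_funM => //; exact/measurable_EFinP.
have step N : (t%:E <= \int[mu]_x (g x)%:E + t%:E * mu (~` E N))%E.
  rewrite -intg'; apply/lee_addgt0Pr => e e0.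
  pose n := (maxn N (Num.bound (t * N%:R / e))).+1.
  have n0 : 0 < n%:R :> R by rewrite ltr0n.
  have Nn : N%:R <= n%:R :> R by rewrite ler_nat leqW// leq_maxl.
  have tn : t * N%:R <= e * n%:R.
    rewrite -ler_pdivrMl// mulrC.
    rewrite (le_trans (ltW (archi_boundP _)))//.
      by rewrite divr_ge0 ?mulr_ge0// ltW.
    by rewrite ler_nat leqW// leq_maxr.
  have : (\int[mu]_(x in setT) (t * (n%:R - N%:R))%:E <=
          \int[mu]_x (\sum_(i < n) g' N (iter i T x))%:E)%E.
    apply: ge0_le_integral => //.
    - by move=> x _; rewrite lee_fin mulr_ge0 ?subr_ge0.
    - by apply/measurable_EFinP; exact: measurable_birkhoff_sum.
    - by move=> x _; rewrite lee_fin block.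
  rewrite integral_birkhoff_sum// integral_cst//= probability_setT mule1.
  rewrite muleC -lee_pdivrMr// => h.
  rewrite -leeBlDr//; apply: (le_trans _ h).
  by rewrite -EFinM -EFinB lee_fin ler_pdivlMr//; lra.
have muE0 : mu (\bigcap_N ~` E N) = 0%E.
  rewrite -setC_bigcup probability_setC; last exact: bigcup_measurable.
  rewrite (_ : \bigcup_N E N = [set x | exists n, n%:R * t < \sum_(i < n) g (iter i T x)]).
    by rewrite mu1 subee.
  apply/seteqP; split=> x /=; first by move=> [N' _ [n _ ?]]; exists n.
  by move=> [n ?]; exists n.+1 => //; exists n.
have cvE : (\int[mu]_x (g x)%:E + t%:E * mu (~` E N))%E @[N --> \oo] -->
    (\int[mu]_x (g x)%:E + t%:E * 0)%E.
  apply: cvgeD; [by rewrite mule0 fin_num_adde_defl|exact: cvg_cst|].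
  apply: cvgeZl => //; rewrite -muE0.
  apply: (@nonincreasing_cvg_mu _ _ _ mu (fun N => ~` E N)).
  - by rewrite (le_lt_trans (probability_le1 _ _))// ?ltry//; exact: measurableC.
  - by move=> i; exact: measurableC.
  - by apply: bigcap_measurable => // i _; exact: measurableC.
  - move=> N N' NN'; apply/subsetPset/subsetC => x [n nN ?].
    by exists n => //; exact: leq_trans NN'.
rewrite mule0 adde0 in cvE.
rewrite -(cvg_lim _ cvE)//; apply: lime_ge; first by apply/cvg_ex; eexists; exact: cvE.
by near=> N; exact: step.
Unshelve. all: by end_near. Qed.

(** A one-sided ergodic theorem: on the set [A] of full measure, the averages
    have an upper limit at most [t]. *)
Lemma ergodic_birkhoff_sum_le g (t : R) :
  (forall A, measurable A -> T @^-1` A = A -> mu A = 0%E \/ mu A = 1%E) ->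
  measurable_fun setT g -> (forall x, 0 <= g x) ->
  (\int[mu]_x (g x)%:E < t%:E)%E ->
  let A := [set x | exists m : nat, forall n,
              \sum_(i < n) g (iter i T x) <= n%:R * t + m%:R] in
  measurable A /\ mu A = 1%E.
Proof.
move=> erg mg g0 gt A.
have t0 : 0 <= t.
  rewrite -lee_fin (le_trans _ (ltW gt))// integral_ge0// => x _.
  by rewrite lee_fin.
have mA : measurable A.
  rewrite (_ : A = \bigcup_m \bigcap_n
      [set x | \sum_(i < n) g (iter i T x) <= n%:R * t + m%:R]).
    apply: bigcup_measurable => m _; apply: bigcap_measurable => // n _.
    rewrite (_ : [set x | _] = ~` [set x | n%:R * t + m%:R < \sum_(i < n) g (iter i T x)]).
      apply/measurableC/measurable_ltr; exact: measurable_birkhoff_sum.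
    apply/seteqP; split => x /=; last by move/negP; rewrite -leNgt.
    by move=> h; apply/negP; rewrite -leNgt.
  apply/seteqP; split => x /= [m]; first by move=> h; exists m => // n _; exact: h.
  by move=> _ h; exists m => n; exact: h.
split=> //.
have S1 n x : \sum_(i < n.+1) g (iter i T x) =
    g x + \sum_(i < n) g (iter i T (T x)).
  rewrite big_ord_recl/=; congr (_ + _).
  by apply: eq_bigr => i _; rewrite /= -iterS iterSr.
(* With [S n x] the sum at [x], the numbers [S n.+1 x - n.+1 * t] and
   [S n (T x) - n * t] differ by an amount that does not depend on [n], so that
   [A] is invariant exactly, and not only up to a null set. *)
have TA : T @^-1` A = A.
  apply/seteqP; split => x /= [m hm].
    exists (m + Num.bound (g x))%N => -[|n].
      by rewrite big_ord0 mul0r add0r.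
    rewrite S1 natrD; have := hm n; have := archi_boundP (g0 x).
    by rewrite -(natr1 n); lra.
  exists (m + Num.bound t)%N => n.
  have := hm n.+1; rewrite S1 natrD; have := archi_boundP t0; have := g0 x.
  by rewrite -(natr1 n); lra.
have [mu0|//] := erg A mA TA.
suff : (t%:E <= \int[mu]_x (g x)%:E)%E by rewrite leNgt gt.
apply: integral_ge_of_sublinear_time => //.
set P := [set x | _]; have mP : measurable P.
  rewrite (_ : P = \bigcup_n [set x | n%:R * t < \sum_(i < n) g (iter i T x)]).
    apply: bigcup_measurable => n _; apply: measurable_ltr.
    exact: measurable_birkhoff_sum.
  by apply/seteqP; split => x /= [n]; exists n.
apply/eqP; rewrite eq_le probability_le1//=.
rewrite -[leLHS]sube0 -mu0 -probability_setC//.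
apply: le_measure; rewrite ?inE//; first exact: measurableC.
move=> x nAx; apply: contrapT => nPx; apply: nAx; exists 0%N => n.
by rewrite addr0 leNgt; apply/negP => h; apply: nPx; exists n.
Qed.

End MeasurePreserving.

(** * Uniform bounds along orbits *)

Section Uniform.
Context {R : realType}.
Implicit Types (c : R) (f : R -> R).

(** The absolute value makes the function nonnegative on the whole line. At [c]
    it takes the value 0, because [ln 0 = 0]. *)
Definition abslog c (x : R) : R := `|ln `|x - c| |.

Lemma lorenz_domP c x : lorenz_dom c x <-> 0 <= x <= 1 /\ x != c.
Proof.
by split=> [[/= + /eqP]|[x01 /eqP xc]]; rewrite ?in_itv//=; split=> //=; rewrite in_itv.
Qed.

Lemma abslogE c x : 0 < c < 1 -> lorenz_dom c x -> abslog c x = - ln `|x - c|.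
Proof.
move=> /andP[c0 c1] /lorenz_domP[/andP[x0 x1] _].
by rewrite /abslog ler0_norm// ln_le0// ler_norml; apply/andP; split; lra.
Qed.

Lemma near_left_dom c : 0 < c < 1 ->
  \forall x \near c^'-, lorenz_dom c x /\ x < c.
Proof.
move=> /andP[c0 c1]; near=> x.
have xc : x < c by near: x; exact: nbhs_left_lt.
have x0 : 0 < x by near: x; exact: nbhs_left_gt.
split=> //; apply/lorenz_domP; split; last by rewrite lt_eqF.
by apply/andP; split; lra.
Unshelve. all: by end_near. Qed.

Lemma near_right_dom c : 0 < c < 1 ->
  \forall x \near c^'+, lorenz_dom c x /\ c < x.
Proof.
move=> /andP[c0 c1]; near=> x.
have xc : c < x by near: x; exact: nbhs_right_gt.
have x0 : x < 1 by near: x; exact: nbhs_right_lt.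
split=> //; apply/lorenz_domP; split; last by rewrite gt_eqF.
by apply/andP; split; lra.
Unshelve. all: by end_near. Qed.

Lemma near_powR_lt c (a K e : R) : 0 < a -> 0 < K -> 0 < e ->
  \forall x \near c, K * `|x - c| `^ a < e.
Proof.
move=> a0 K0 e0; exists ((e / K) `^ a^-1) => /=; first by apply: powR_gt0; rewrite divr_gt0.
move=> x /= xd; rewrite mulrC -ltr_pdivlMr//.
have -> : e / K = ((e / K) `^ a^-1) `^ a.
  by rewrite -powRrM mulVf ?gt_eqF// powRr1// divr_ge0// ltW.
by apply: gt0_ltr_powR; rewrite ?nnegrE ?powR_ge0// distrC.
Qed.

Lemma cvg_one_sided_limit c f (a K v : R) (F : set_system R) : Filter F ->
  0 < a -> 0 < K -> F --> c ->
  (\forall x \near F, `|f x - v| <= K * `|x - c| `^ a) -> f x @[x --> F] --> v.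
Proof.
move=> FF a0 K0 Fc H; apply/cvgrPdist_lt => e e0.
apply: filterS2 H (Fc _ (near_powR_lt c a0 K0 e0)) => x h1 h2.
by rewrite distrC (le_lt_trans h1).
Qed.

Lemma birkhoff_sum_min_le c f : expanding_lorenz c f -> non_flat c f ->
  (limn_esup (critical_average c (iter_left c f)) < +oo)%E ->
  (limn_esup (critical_average c (iter_right c f)) < +oo)%E ->
  exists2 C : R, 0 <= C &
    forall x, (forall n, lorenz_dom c (iter n f x)) ->
    forall n (B : R), 0 <= B ->
      \sum_(i < n) Num.min (abslog c (iter i f x)) B <= C * n%:R + B.
Proof.
move=> Lf NF hl hr.
have c01 := lorenz_c01 Lf.
have [v0 [v1 [K [a [K1 a01 near_v secant]]]]] := lorenz_estimates Lf NF.
have [a0 a1] := andP a01.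
have K0 : 0 < K := lt_le_trans ltr01 K1.
have nl := near_left_dom c01; have nr := near_right_dom c01.
have cvl : f x @[x --> c^'-] --> v0.
  apply: (cvg_one_sided_limit _ a0 K0) => //; first exact: cvg_within.
  by apply: filterS nl => x [dx xc]; have := near_v x dx; rewrite xc.
have cvr : f x @[x --> c^'+] --> v1.
  apply: (cvg_one_sided_limit _ a0 K0) => //; first exact: cvg_within.
  by apply: filterS nr => x [dx xc]; have := near_v x dx; rewrite ltNge (ltW xc).
have dl : (c^'-) (lorenz_dom c) by apply: filterS nl => x [].
have dr : (c^'+) (lorenz_dom c) by apply: filterS nr => x [].
have [pl1 pld plS [Ml Ml0 sl]] := critical_orbit _ Lf dl cvl hl.
have [pr1 prd prS [Mr Mr0 sr]] := critical_orbit _ Lf dr cvr hr.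
pose M := Ml + Mr.
have M0 : 0 <= M by rewrite addr_ge0.
pose C := (ln K + ln 2 + M) / a + M + ln 2.
have ln20 : 0 <= ln 2 :> R by apply: ln_ge0; lra.
have C0 : 0 <= C by rewrite !addr_ge0// divr_ge0 ?(ltW a0)// !addr_ge0// ln_ge0.
exists C => // x domx.
have dich y n : (forall n, lorenz_dom c (iter n f y)) ->
  (exists2 p, (0 < p <= n)%N & \sum_(i < p) - ln `|iter i f y - c| <= C * p%:R) \/
  \sum_(1 <= i < n) - ln `|iter i f y - c| <= C * n%:R.
  move=> domy; have nv := near_v _ (domy 0%N).
  have [yc|yc] := boolP (y < c); [rewrite /= yc in nv|rewrite /= (negbTE yc) in nv].
    apply: (block_dichotomy K1 a01 M0 secant domy (w := fun j => iter_left c f j.+1)) => //.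
      by rewrite /iter_left pl1.
    by move=> m; apply: le_trans (sl m) _; rewrite ler_wpM2r// lerDl.
  apply: (block_dichotomy K1 a01 M0 secant domy (w := fun j => iter_right c f j.+1)) => //.
    by rewrite /iter_right pr1.
  by move=> m; apply: le_trans (sr m) _; rewrite ler_wpM2r// lerDr.
have minl B i y : lorenz_dom c (iter i f y) ->
    Num.min (abslog c (iter i f y)) B <= - ln `|iter i f y - c|.
  by move=> d; rewrite ge_min abslogE// lexx.
move=> n B B0; elim/ltn_ind: n x domx => n IH x domx.
have [[p /andP[p0 pn] hp]|h] := dich x n domx.
  rewrite (birkhoff_sum_split _ (fun y => Num.min (abslog c y) B) _ pn)/=.
  have -> : C * n%:R + B = C * p%:R + (C * (n - p)%:R + B).
    by rewrite natrB//; ring.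
  apply: lerD; last first.
    apply: IH; first by rewrite ltn_subrL p0 (leq_trans p0 pn).
    by move=> m; rewrite -iterD.
  by apply: le_trans hp; apply: ler_sum => i _; exact: minl.
case: n IH h => [|n] _ h; first by rewrite big_ord0 mulr0 add0r.
rewrite -(big_mkord predT (fun i => Num.min (abslog c (iter i f x)) B)).
rewrite big_ltn//= addrC; apply: lerD; last by rewrite ge_min lexx orbT.
by apply: le_trans h; apply: ler_sum => i _; exact: minl.
Qed.

Lemma derive_within_le c f : expanding_lorenz c f -> non_flat c f ->
  exists2 K : R, 1 <= K &
    forall x, lorenz_dom c x ->
      ln (derive_within (lorenz_dom c) f x) <= ln K + abslog c x.
Proof.
move=> Lf NF; have c01 := lorenz_c01 Lf.
have [v0 [v1 [K [a [K1 a01 _ secant]]]]] := lorenz_estimates Lf NF.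
have [s s1 Hs] := lorenz_expanding Lf.
exists K => // x dx.
have [x01 xc] := (lorenz_domP c x).1 dx.
have K0 : 0 < K := lt_le_trans ltr01 K1.
have r0 : 0 < `|x - c| by rewrite normr_gt0 subr_eq0.
suff H : derive_within (lorenz_dom c) f x <= K / `|x - c|.
  have : ln (derive_within (lorenz_dom c) f x) <= ln (K / `|x - c|).
    rewrite ler_ln ?posrE ?divr_gt0// (lt_le_trans _ (Hs _ dx))//.
    by rewrite (lt_trans ltr01).
  by rewrite lnM ?posrE ?invr_gt0// lnV ?posrE// abslogE.
apply/ler_addgt0Pr => e e0.
have ddx := let: And3 h _ _ := lorenz_C1plus Lf in h x dx.
have [d d0 Hd] := derivable_withinP ddx e0.
(* A point between [x] and [c], on the same side of [c] and arbitrarily near [x]. *)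
have [y [dy yx yd side]] : exists y, [/\ lorenz_dom c y, y != x, `|y - x| < d &
    (y < c) = (x < c)].
  case/andP: c01 => c0 c1; case/andP: (x01) => x0 x1.
  have m0 : 0 < Num.min d `|x - c| by rewrite lt_min d0.
  set h := Num.min d `|x - c| / 2; have h0 : 0 < h by rewrite divr_gt0.
  have hd : h < d by rewrite /h ltr_pdivrMr// gt_min ltr_pMr// ltr1n.
  have hr : h < `|x - c| by rewrite /h ltr_pdivrMr// gt_min (ltr_pMr _ r0) ltr1n orbT.
  have [xlt|xge] := ltP x c.
    have {}hr : x + h < c by move: hr; rewrite ltr0_norm ?subr_lt0//; lra.
    exists (x + h); split.
    - apply/lorenz_domP; split; last by rewrite lt_eqF.
      by apply/andP; split; lra.
    - by rewrite gt_eqF// ltrDl.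
    - by rewrite addrAC subrr add0r gtr0_norm.
    - by rewrite hr.
  have {}hr : c < x - h.
    by move: hr; rewrite ger0_norm ?subr_ge0//; lra.
  exists (x - h); split.
  - apply/lorenz_domP; split; last by rewrite gt_eqF.
    by apply/andP; split; lra.
  - by rewrite lt_eqF// gtrDl oppr_lt0.
  - by rewrite addrAC subrr add0r normrN gtr0_norm.
  - by apply/negbTE; rewrite -leNgt ltW.
have := Hd y dy yd yx; rewrite ltr_norml => /andP[_ h].
have yx0 : 0 < `|y - x| by rewrite normr_gt0 subr_eq0.
have : slope f x y <= K / `|x - c|.
  rewrite (le_trans (ler_norm _))// /slope normrM normfV ler_pdivrMr//.
  by rewrite (le_trans (secant y x dy dx side))// mulrA mulrAC.
lra.
Qed.

End Uniform.

(** * Invariant probabilities of Lorenz maps *)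

Section Probability.
Context {R : realType}.
Variables (c : R) (f : R -> R).
Hypothesis Lf : expanding_lorenz c f.
Variable mu : probability (measurableTypeR R) R.
Hypothesis muf : invariant_prob c f mu.

Local Notation X := (measurableTypeR R).
Let D : set X := lorenz_dom c.

Lemma measurable_lorenz_dom : measurable D.
Proof. by apply: measurableD => //; exact: measurable_set1. Qed.
Let mD := measurable_lorenz_dom.

Lemma lorenz_dom_prob1 : mu D = 1%E.
Proof.
have [mu1 muI] := muf.
have := muI [set` `[0%R, 1%R]] (measurable_itv _) (@subset_refl _ _).
rewrite mu1 => <-; congr (mu _); apply/seteqP; split=> x /=; last by case.
by move=> dx; split=> //; exact: (lorenz_fun Lf).
Qed.

(** The invariance hypothesis applied to [[0, 1]] shows that [c] is null. *)
Lemma lorenz_domC_prob0 : mu (~` D) = 0%E.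
Proof. by rewrite probability_setC// lorenz_dom_prob1 subee. Qed.

Lemma prob_setI_full (A E : set X) : measurable A -> measurable E -> mu E = 1%E ->
  mu (A `&` E) = mu A.
Proof.
move=> mA mE mu1; rewrite [RHS](measureDI mu mA mE).
rewrite -[LHS]add0e; congr (_ + _)%E; apply/esym.
apply/eqP; rewrite -measure_le0.
have <- : mu (~` E) = 0%E by rewrite probability_setC// mu1 subee.
by apply: le_measure; rewrite ?inE; [exact: measurableD|exact: measurableC|move=> x []].
Qed.

Lemma ae_prob1 (A : set X) : measurable A -> (\forall x \ae mu, A x) ->
  mu A = 1%E.
Proof.
move=> mA h; have h0 : mu (~` A) = 0%E.
  by apply: measure_negligible => //; exact: measurableC.
rewrite -[A]setCK probability_setC; last exact: measurableC.
by rewrite h0 sube0.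
Qed.

Lemma prob1_ae (A : set X) : measurable A -> mu A = 1%E ->
  \forall x \ae mu, A x.
Proof.
move=> mA h; exists (~` A); split => //; first exact: measurableC.
by rewrite probability_setC// h subee.
Qed.

(** The map extended by 0 off its domain: a measurable self-map of the line, to
    which the results on measure-preserving transformations apply. *)
Definition lorenz_total : X -> X := f \_ D.

Lemma lorenz_totalE x : D x -> lorenz_total x = f x.
Proof. by move=> Dx; rewrite /lorenz_total patchE mem_set. Qed.

Lemma iter_lorenz_total x : (forall n, D (iter n lorenz_total x)) ->
  forall n, iter n lorenz_total x = iter n f x.
Proof.
move=> Dx; elim=> // n IH.
by rewrite iterS lorenz_totalE// IH.
Qed.

Lemma measurable_lorenz_total : measurable_fun setT lorenz_total.
Proof.
apply/(measurable_restrictT f mD).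
apply: subspace_continuous_measurable_fun => //.
exact: derivable_within_continuous (let: And3 h _ _ := lorenz_C1plus Lf in h).
Qed.

Lemma lorenz_total_invariant A : measurable A -> mu (lorenz_total @^-1` A) = mu A.
Proof.
move=> mA; have [mu1 muI] := muf.
have mpre : measurable (lorenz_total @^-1` A).
  by rewrite -[_ @^-1` _]setTI; exact: measurable_lorenz_total.
rewrite -(prob_setI_full mpre mD lorenz_dom_prob1).
rewrite -(prob_setI_full mA (measurable_itv `[0, 1]) mu1).
rewrite -(muI (A `&` [set` `[0%R, 1%R]])); [|exact: measurableI|by move=> x []].
congr (mu _); apply/seteqP; split => x /=.
  move=> [Ax Dx]; rewrite lorenz_totalE// in Ax; split=> //; split => //.
  exact: (lorenz_fun Lf).
by move=> [Dx [Ax _]]; rewrite lorenz_totalE.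
Qed.

(** The points whose forward orbit stays in the domain, hence avoids [c]. *)
Definition regular_points : set X :=
  [set x | forall n, D (iter n lorenz_total x)].

Lemma measurable_regular_points : measurable regular_points.
Proof.
rewrite (_ : regular_points = \bigcap_n (iter n lorenz_total @^-1` D)).
  apply: bigcap_measurable => // n _; rewrite -[_ @^-1` _]setTI.
  exact: (measurable_iter measurable_lorenz_total).
by apply/seteqP; split => x /= h n => [_|]; exact: h.
Qed.

Lemma ae_regular_points : \forall x \ae mu, regular_points x.
Proof.
apply: ae_foralln => n; exists (iter n lorenz_total @^-1` (~` D)); split => //.
- rewrite -[_ @^-1` _]setTI; apply: (measurable_iter measurable_lorenz_total) => //.
  exact: measurableC.
- elim: n => [|n IH]; first exact: lorenz_domC_prob0.
  rewrite -{}IH -[RHS]lorenz_total_invariant.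
    by congr (mu _); apply/seteqP; split => x; rewrite /preimage/= -iterS iterSr.
  rewrite -[_ @^-1` _]setTI; apply: (measurable_iter measurable_lorenz_total) => //.
  exact: measurableC.
Qed.

Lemma regular_points_prob1 : mu regular_points = 1%E.
Proof.
exact: ae_prob1 measurable_regular_points ae_regular_points.
Qed.

Lemma measurable_abslog : measurable_fun setT (abslog c : X -> R).
Proof.
apply: measurableT_comp => //; apply: measurableT_comp; first exact: measurable_ln.
by apply: measurableT_comp => //; apply: measurable_funB.
Qed.

Lemma integral_abslog_le (C : R) : 0 <= C ->
  (forall x, (forall n, lorenz_dom c (iter n f x)) ->
    forall n (B : R), 0 <= B ->
      \sum_(i < n) Num.min (abslog c (iter i f x)) B <= C * n%:R + B) ->
  (\int[mu]_x (abslog c x)%:E <= C%:E)%E.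
Proof.
move=> C0 HC.
apply: (integral_le_of_birkhoff_sum_min measurable_lorenz_total) => //.
- exact: lorenz_total_invariant.
- exact: measurable_abslog.
- by move=> x; exact: normr_ge0.
apply: filterS ae_regular_points => x rx n B B0.
have E := iter_lorenz_total rx.
under eq_bigr do rewrite E.
by apply: HC => // m; rewrite -E; exact: rx.
Qed.

Lemma integral_lne_le (C : R) : (\int[mu]_x (abslog c x)%:E <= C%:E)%E ->
  (\int[mu]_(x in `[0%R, 1%R]) `|lne `|x - c|%:E| <= C%:E)%E.
Proof.
apply: le_trans.
(* The two integrands differ only at [c], where the first is infinite. *)
have H (x : R) : `|lne `|x - c|%:E|%E = if x == c then +oo%E else (abslog c x)%:E.
  case: eqVneq => [->|xc]; first by rewrite subrr normr0 le0_lneNy//.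
  by rewrite lne_EFin ?normr_gt0 ?subr_eq0.
have mH : measurable_fun setT (fun x : X => `|lne `|x - c|%:E|%E).
  rewrite (_ : (fun _ => _) = fun x : X => if x == c then +oo%E else (abslog c x)%:E).
    apply: measurable_fun_ifT => //.
      by apply: measurable_fun_eqr.
    by apply/measurable_EFinP; exact: measurable_abslog.
  by apply/funext => x; exact: H.
apply: (@le_trans _ _ (\int[mu]_x `|lne `|x - c|%:E|))%E.
  by apply: ge0_subset_integral.
apply: ae_ge0_le_integral => //.
- by move=> x _; rewrite lee_fin normr_ge0.
- by apply/measurable_EFinP; exact: measurable_abslog.
- exists (~` D); split; [exact: measurableC|exact: lorenz_domC_prob0|].
  move=> x /=; apply: contra_not => /lorenz_domP[_ xc] _.
  by rewrite H (negbTE xc).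
Qed.

Lemma lyapunov_exponent_le (C K : R) : 1 <= K ->
  (forall x, lorenz_dom c x ->
    ln (derive_within (lorenz_dom c) f x) <= ln K + abslog c x) ->
  (\int[mu]_x (abslog c x)%:E <= C%:E)%E ->
  (lyapunov_exponent c f mu <= (ln K + C)%:E)%E.
Proof.
move=> K1 HK HC; rewrite /lyapunov_exponent.
have [s s1 Hs] := lorenz_expanding Lf.
have mg : measurable_fun setT (fun x : X => (ln K + abslog c x)%:E).
  by apply/measurable_EFinP; apply: measurable_funD => //; exact: measurable_abslog.
have lnK0 : 0 <= ln K by exact: ln_ge0.
apply: (@le_trans _ _ (\int[mu]_(x in D) (ln K + abslog c x)%:E)%E).
  apply: ge0_le_integral => //.
  - by move=> x Dx; rewrite lee_fin ln_ge0// (le_trans (ltW s1))// Hs.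
  - apply/measurable_EFinP; apply: measurableT_comp; first exact: measurable_ln.
    apply: subspace_continuous_measurable_fun => //.
    exact: (let: And3 _ h _ := lorenz_C1plus Lf in h).
  - exact: measurable_funTS mg.
apply: (@le_trans _ _ (\int[mu]_x (ln K + abslog c x)%:E)%E).
  by apply: ge0_subset_integral => // x _; rewrite lee_fin addr_ge0// normr_ge0.
under eq_integral do rewrite EFinD.
rewrite ge0_integralD//.
- by rewrite integral_cst//= probability_setT mule1 EFinD leeD.
- by move=> x _; rewrite lee_fin normr_ge0.
- by apply/measurable_EFinP; exact: measurable_abslog.
Qed.

End Probability.

(** * Slow recurrence and conclusion *)

Section SlowRecurrence.
Context {R : realType}.
Implicit Types (c : R) (f : R -> R).

(** On the domain of the map, minus the logarithm of the truncated distance to [c]. *)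
Definition near_abslog c (delta x : R) : R :=
  if `|x - c| <= delta then abslog c x else 0.

Lemma near_abslog_ge0 c delta x : 0 <= near_abslog c delta x.
Proof. by rewrite /near_abslog; case: ifP => // _; exact: normr_ge0. Qed.

Lemma neglog_trunc_dist c delta x : 0 < c < 1 -> lorenz_dom c x ->
  neglog (trunc_dist c delta x) = (near_abslog c delta x)%:E.
Proof.
move=> c01 dx; rewrite /trunc_dist /near_abslog; case: ifP => _.
  rewrite neglogE; first by rewrite abslogE.
  by have [_ xc] := (lorenz_domP c x).1 dx; rewrite normr_gt0 subr_eq0.
by rewrite neglogE// ln1 oppr0.
Qed.

Lemma measurable_near_abslog c delta :
  measurable_fun setT (near_abslog c delta : measurableTypeR R -> R).
Proof.
apply: measurable_fun_ifT => //; last exact: measurable_abslog.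
by apply: measurable_fun_ler => //; apply: measurableT_comp => //; apply: measurable_funB.
Qed.

Lemma near_abslog_small c (mu : probability (measurableTypeR R) R) (e : R) :
  (\int[mu]_x (abslog c x)%:E < +oo)%E -> 0 < e ->
  exists2 delta : R, 0 < delta & (\int[mu]_x (near_abslog c delta x)%:E < e%:E)%E.
Proof.
move=> fin e0.
have cv : ((\int[mu]_x (near_abslog c n.+1%:R^-1 x)%:E) @[n --> \oo] -->
    \int[mu]_x (cst 0 x))%E.
  apply: (@dominated_cvg _ _ _ mu setT measurableT
    (fun n x => (near_abslog c n.+1%:R^-1 x)%:E) (cst 0%E)
    (fun x => (abslog c x)%:E)) => //.
  - by move=> n; apply/measurable_EFinP; exact: measurable_near_abslog.
  - move=> x _; have [->|xc] := eqVneq x c.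
      apply: cvg_near_cst; apply: nearW => n.
      by rewrite /near_abslog /abslog subrr normr0 ln0// normr0 if_same.
    have xc0 : 0 < `|x - c| by rewrite normr_gt0 subr_eq0.
    apply: cvg_near_cst.
    near=> n; rewrite /near_abslog ifF//; apply/negbTE; rewrite -ltNge.
    near: n; exact: (near_infty_natSinv_lt (PosNum xc0)).
  - apply/integrableP; split.
      by apply/measurable_EFinP; exact: measurable_abslog.
    by under eq_integral do rewrite /= ger0_norm ?normr_ge0//.
  - move=> n x _; rewrite lee_fin ger0_norm ?near_abslog_ge0//.
    by rewrite /near_abslog; case: ifP => // _; exact: normr_ge0.
have : \forall n \near \oo, (\int[mu]_x (near_abslog c n.+1%:R^-1 x)%:E < e%:E)%E.
  apply: (cv [set y | (y < e%:E)%E]); apply: open_nbhs_nbhs; split.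
    exact: open_ereal_lt_ereal.
  by rewrite /= integral0 lte_fin.
by move=> [n _ /(_ n (leqnn _)) h]; exists n.+1%:R^-1.
Unshelve. all: by end_near. Qed.

Lemma limn_esup_le_near (u : (\bar R)^nat) (l : \bar R) :
  (\forall n \near \oo, (u n <= l)%E) -> (limn_esup u <= l)%E.
Proof.
move=> H; apply: ereal_inf_le; exists (ereal_sup [set u x | x in [set n | (u n <= l)%E]]).
  by exists [set n | (u n <= l)%E].
by apply: ub_ereal_sup => _ [n /= ? <-].
Qed.

(** The set [Lambda] must serve all [epsilon] at once: it is the intersection of
    full measure sets [A k], where [A k] handles the tolerance [1 / (k + 1)]. *)
Lemma slow_recurrence_of_integrable c f (mu : probability (measurableTypeR R) R) :
  expanding_lorenz c f -> invariant_prob c f mu -> ergodic c f mu ->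
  (\int[mu]_x (abslog c x)%:E < +oo)%E -> slow_recurrence_prob c f mu.
Proof.
move=> Lf muf erg fin; have c01 := lorenz_c01 Lf.
set T := lorenz_total c f.
have mT : measurable_fun setT T := measurable_lorenz_total Lf.
have muT := lorenz_total_invariant Lf muf.
have mG : measurable (regular_points c f) := measurable_regular_points Lf.
(* An invariant set of the extended map becomes strictly invariant for the
   Lorenz map once intersected with the regular points. *)
have ergT A : measurable A -> T @^-1` A = A -> mu A = 0%E \/ mu A = 1%E.
  move=> mA TA; have <- := prob_setI_full mA mG (regular_points_prob1 Lf muf).
  apply: erg; first exact: measurableI.
    by move=> x [_ rx]; have [] := rx 0%N.
  apply/seteqP; split => x /=.
    move=> [Dx [Afx Gfx]].
    have Tx : T x = f x := lorenz_totalE f Dx.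
    split; first by rewrite -TA /preimage/= Tx.
    by case=> // n; rewrite iterSr -/T Tx; exact: Gfx.
  move=> [Ax Gx]; have Dx : lorenz_dom c x := Gx 0%N.
  have Tx : T x = f x := lorenz_totalE f Dx.
  split=> //; split; first by rewrite -Tx; rewrite -TA in Ax.
  by move=> n; rewrite -Tx -iterSr; exact: (Gx n.+1).
have ex k : exists delta : R, 0 < delta /\
    (\int[mu]_x (near_abslog c delta x)%:E < (k.+1%:R^-1)%:E)%E.
  have [|d d0 hd] := near_abslog_small fin (e := k.+1%:R^-1); first by rewrite invr_gt0.
  by exists d.
have [delta Hdelta] := choice ex.
pose A k := [set x : measurableTypeR R | exists m : nat, forall n,
  \sum_(i < n) near_abslog c (delta k) (iter i T x) <= n%:R * k.+1%:R^-1 + m%:R].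
have HA k : measurable (A k) /\ mu (A k) = 1%E.
  apply: (ergodic_birkhoff_sum_le mT muT ergT).
  - exact: measurable_near_abslog.
  - by move=> x; exact: near_abslog_ge0.
  - by have [] := Hdelta k.
pose Lambda := (\bigcap_k A k) `&` regular_points c f.
have mL : measurable Lambda.
  by apply: measurableI => //; apply: bigcap_measurable => // k _; have [] := HA k.
exists Lambda; split => //.
- by move=> x [_ rx]; have [] := rx 0%N.
- move=> e e0.
  have [k _ /(_ k (leqnn _)) ke] := near_infty_natSinv_lt (PosNum e0).
  have [d0 _] := Hdelta k; exists (delta k) => // x [Ax Gx].
  have [m Hm] := Ax k I.
  have E := iter_lorenz_total Gx.
  apply: limn_esup_le_near; near=> n.
  have n0 : 0 < n%:R :> R by rewrite ltr0n; near: n; exact: nbhs_infty_gt.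
  rewrite big_mkord (eq_bigr (fun i : 'I_n =>
    (near_abslog c (delta k) (iter i T x))%:E)).
    rewrite sumEFin -EFinM lee_fin mulrC ler_pdivrMr// (le_trans (Hm n))//.
    have : m%:R / (e - k.+1%:R^-1) <= n%:R.
      rewrite (le_trans (ltW (archi_boundP _)))//.
        by rewrite divr_ge0// subr_ge0 ltW.
      by rewrite ler_nat; near: n; exact: nbhs_infty_ge.
    by rewrite ler_pdivrMr ?subr_gt0// mulrBr lerBrDr addrC (mulrC e).
  by move=> i _; rewrite /T E neglog_trunc_dist// -E; exact: Gx.
- apply: ae_prob1 => //.
  apply: filterS2 (ae_foralln (fun k => prob1_ae (HA k).1 (HA k).2))
    (ae_regular_points Lf muf).
  by move=> x h1 h2; split => // k _; exact: h1.
Unshelve. all: by end_near. Qed.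

End SlowRecurrence.

Local Open Scope ereal_scope.

Theorem theorem3 (R : realType) (c : R) (f : R -> R) :
  expanding_lorenz c f ->
  non_flat c f ->
  limn_esup (critical_average c (iter_left c f)) < +oo ->
  limn_esup (critical_average c (iter_right c f)) < +oo ->
  [/\ exists2 Upsilon : R, (0 < Upsilon)%R &
        forall mu : probability (measurableTypeR R) R,
          invariant_prob c f mu ->
          \int[mu]_(x in `[0%R, 1%R]) `|lne `|x - c|%:E| <= Upsilon%:E,
      forall mu : probability (measurableTypeR R) R,
        invariant_prob c f mu -> ergodic c f mu ->
        slow_recurrence_prob c f mu &
      exists L : R,
        forall mu : probability (measurableTypeR R) R,
          invariant_prob c f mu -> lyapunov_exponent c f mu <= L%:E].
Proof.
move=> Lf NF hl hr.
have [C C0 HC] := birkhoff_sum_min_le Lf NF hl hr.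
have int_le mu (muf : invariant_prob c f mu) := integral_abslog_le Lf muf C0 HC.
split.
- exists (C + 1)%R => [|mu muf]; first by rewrite ltr_wpDl.
  apply: (integral_lne_le Lf muf); apply: le_trans (int_le mu muf) _.
  by rewrite lee_fin lerDl.
- move=> mu muf erg; apply: slow_recurrence_of_integrable => //.
  exact: le_lt_trans (int_le mu muf) (ltry _).
- have [K K1 HK] := derive_within_le Lf NF.
  exists (ln K + C)%R => mu muf.
  exact: (lyapunov_exponent_le Lf K1 HK (int_le mu muf)).
Qed.
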